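(* Let $d\ge 2$, let $\mathcal{H}$ be a $d$-dimensional complex Hilbert space, and let $\mathbb{P}=\{\mathcal{P}^{(1)},\ldots,\mathcal{P}^{(M)}\}$ be a set of $M$ mutually unbiased measurements of efficiency $\varkappa$ on $\mathcal{H}$. Then for every $\alpha\in(0,2]$ and every density matrix $\rho$ on $\mathcal{H}$ (pure or mixed), the following state-independent bound holds: $$\frac{1}{M}\sum_{\mathcal{P}\in\mathbb{P}} H_{\alpha}(\mathcal{P}|\rho)\;\geq\;\ln_{\alpha}\!\left(\frac{Md}{M+\varkappa d-1}\right).$$
   Context: A density matrix on $\mathcal{H}$ is a positive semidefinite operator $\rho$ with $\mathrm{Tr}(\rho)=1$. A POVM with $d$ elements is a family of positive semidefinite operators $\{P_n\}_{n=1}^d$ on $\mathcal{H}$ with $\sum_n P_n=I$ (the identity). A set $\mathbb{P}=\{\mathcal{P}^{(1)},\ldots,\mathcal{P}^{(M)}\}$ of POVMs $\mathcal{P}^{(b)}=\{P^{(b)}_n\}_{n=1}^d$, each with $d$ elements (an indexed family, $b=1,\dots,M$), is a set of $M$ mutually unbiased measurements (MUMs) of efficiency $\varkappa$ if: (i) $\mathrm{Tr}(P^{(b)}_n)=1$ for all $b,n$; (ii) $\mathrm{Tr}(P^{(a)}_mP^{(b)}_n)=\frac1d$ for all $a\neq b$ and all $m,n$; (iii) for all $b,m,n$, $\mathrm{Tr}(P^{(b)}_mP^{(b)}_n)=\delta_{mn}\,\varkappa+(1-\delta_{mn})\frac{1-\varkappa}{d-1}$. Here $\varkappa$ is a real parameter,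 for which $1/d\le\varkappa\le 1$. Sums over $\mathcal{P}\in\mathbb{P}$ mean sums over $b=1,\dots,M$. For a POVM $\mathcal{P}=\{P_n\}_{n=1}^d$ and density matrix $\rho$, the outcome probabilities are $p_n(\mathcal{P}|\rho)=\mathrm{Tr}(P_n\rho)$, and $H_\alpha(\mathcal{P}|\rho)$ denotes the Tsallis $\alpha$-entropy of this distribution: $H_{\alpha}(p)=\frac{1}{1-\alpha}\left(\sum_n p_n^{\alpha}-1\right)$ for $\alpha>0$, $\alpha\neq1$ (with $0^\alpha=0$), and $H_1(p)=-\sum_n p_n\ln p_n$ (Shannon entropy, with $0\ln 0=0$). The $\alpha$-logarithm of $x>0$ is $\ln_{\alpha}(x)=\frac{x^{1-\alpha}-1}{1-\alpha}$ for $\alpha\neq 1$ and $\ln_1(x)=\ln x$. *)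

(* Defs.v *)
From mathcomp Require Import all_boot all_order all_algebra.
From mathcomp Require Import complex.
From mathcomp Require Import reals exp.

Set Implicit Arguments.
Unset Strict Implicit.
Unset Printing Implicit Defensive.

Import Order.TTheory GRing.Theory Num.Theory.

Local Open Scope ring_scope.
Local Open Scope complex_scope.
Local Open Scope sesquilinear_scope.

(* The d-dimensional Hilbert space is C^d = 'cV[R[i]]_d with inner product
   <u, v> = u^t* v; a linear operator is its matrix, acting on columns. In the
   order of R[i], 0 <= z means that z is real and nonnegative. *)
Definition psdmx (R : realType) (d : nat) (A : 'M[R[i]]_d) : Prop :=
  A \is hermsymmx /\ forall v : 'cV[R[i]]_d, 0 <= (v ^t* *m A *m v) 0 0.

Definition density_matrix (R : realType) (d : nat) (rho : 'M[R[i]]_d) : Prop :=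
  psdmx rho /\ \tr rho = 1.

Definition POVM (R : realType) (d k : nat) (P : 'I_k -> 'M[R[i]]_d) : Prop :=
  (forall n, psdmx (P n)) /\ \sum_n P n = 1%:M.

Record MUM (R : realType) (d M : nat) (kappa : R)
    (P : 'I_M -> 'I_d -> 'M[R[i]]_d) : Prop := {
  MUM_povm : forall b, POVM (P b);
  MUM_kappa : d%:R^-1 <= kappa <= 1;
  MUM_trace : forall b n, \tr (P b n) = 1;
  MUM_unbiased : forall a b m n, a != b -> \tr (P a m *m P b n) = d%:R^-1;
  MUM_efficiency : forall b m n, \tr (P b m *m P b n) =
    (if m == n then kappa else (1 - kappa) / (d%:R - 1))%:C }.

(* The trace of a product of two psd matrices is real, so taking the real part
   only changes the type from R[i] to R. *)
Definition outcome_prob (R : realType) (d k : nat) (P : 'I_k -> 'M[R[i]]_d)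
    (rho : 'M[R[i]]_d) : 'I_k -> R :=
  fun n => complex.Re (\tr (P n *m rho)).

(* For alpha > 0, powR gives 0 `^ alpha = 0, and 0 * ln 0 = 0. *)
Definition tsallis (R : realType) (k : nat) (alpha : R) (p : 'I_k -> R) : R :=
  if alpha == 1 then - \sum_n p n * ln (p n)
  else (1 - alpha)^-1 * (\sum_n p n `^ alpha - 1).

Definition entropy (R : realType) (d k : nat) (alpha : R)
    (P : 'I_k -> 'M[R[i]]_d) (rho : 'M[R[i]]_d) : R :=
  tsallis alpha (outcome_prob P rho).

(* Meant for x > 0. *)
Definition ln_alpha (R : realType) (alpha x : R) : R :=
  if alpha == 1 then ln x else (x `^ (1 - alpha) - 1) / (1 - alpha).

(* Main.v *)
(** With [f y = ln_alpha (1 / y)], convex and decreasing for [0 < alpha <= 2],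
    the Tsallis entropy is [\sum_n p_n f(p_n)]. Bounding [f] below by its tangent
    at [c = (M + kappa d - 1) / (M d)] reduces the claim to the inequality
    [\sum_b \sum_n p_n(b)^2 <= M c] on the outcome probabilities. Since distinct
    measurements are orthogonal on the traceless part of the operators, the
    latter is a Bessel inequality for [rho - 1 / d], whose squared Hilbert-Schmidt
    norm is at most [1 - 1 / d]. *)

Require Import Defs.
From mathcomp Require Import all_boot all_order all_algebra.
From mathcomp Require Import complex.
From mathcomp Require Import reals exp.
From mathcomp Require Import ring lra.

Import Order.TTheory GRing.Theory Num.Theory.

Local Open Scope ring_scope.
Local Open Scope complex_scope.
Local Open Scope sesquilinear_scope.

(** * Tangent-line bounds for the Tsallis entropy *)

Lemma ln_le_subr1 {R : realType} {x : R} : 0 < x -> ln x <= x - 1.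
Proof.
move=> x0; have -> : ln x = ln (1 + (x - 1)) by congr ln; ring.
by apply: le_ln1Dx; rewrite ltrBDl subrr.
Qed.

(** Bernoulli's inequality for real exponents changes direction with the sign of the exponent; the
    factor [b] on both sides covers both directions at once. It serves with [b = alpha - 1], hence
    [b <= 1]. *)
Lemma bernoulli_powR {R : realType} {b r : R} : b <= 1 -> 0 < r ->
  b * r `^ b <= b * (1 + b * (r - 1)).
Proof.
move=> b1 r0; have lr := ln_le_subr1 r0.
case: (ltgtP b 0) => [b0|b0|->]; last by rewrite !mul0r.
- rewrite ler_nM2l // /powR gt_eqF //.
  (* The power is [expR (b * ln r) >= 1 + b * ln r], and [b < 0] reverses [ln r <= r - 1]. *)
  apply: le_trans (expR_ge1Dx _); rewrite lerD2l.
  by rewrite ler_nM2l.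
- rewrite ler_pM2l // /powR gt_eqF //.
  set s := 1 + _.
  have s0 : 0 < s by rewrite /s; nra.
  rewrite -[leRHS](lnK (x := s)) ?posrE // ler_expR.
  (* Averaging [ln x <= x - 1] at [r / s] and [1 / s] with weights [b], [1 - b]. *)
  have h1 : ln r - ln s <= r / s - 1.
    by rewrite -ln_div ?posrE // ln_le_subr1 // divr_gt0.
  have h2 : - ln s <= s^-1 - 1.
    by rewrite -lnV ?posrE // ln_le_subr1 // invr_gt0.
  have e : b * (r / s - 1) + (1 - b) * (s^-1 - 1) = 0.
    transitivity ((1 + b * (r - 1)) / s - 1); last by rewrite divff ?subrr ?lt0r_neq0.
    by field; rewrite lt0r_neq0.
  nra.
Qed.

(* Tangent line at [c] of the convex function [y |-> ln_alpha (1 / y)]. *)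
Lemma ln_alphaV_tangent {R : realType} {alpha c y : R} :
  alpha <= 2 -> 0 < c -> 0 < y ->
  ln_alpha alpha c^-1 - c `^ (alpha - 2) * (y - c) <= ln_alpha alpha y^-1.
Proof.
move=> a2 c0 y0; rewrite /ln_alpha.
have r0 : 0 < y / c by rewrite divr_gt0.
have cn : c != 0 by rewrite lt0r_neq0.
have [->|an] := eqVneq alpha 1.
  have -> : 1 - 2 = -1 :> R by ring.
  rewrite powR_inv1 ?(ltW c0) // !lnV ?posrE //.
  have := ln_le_subr1 r0; rewrite ln_div ?posrE //.
  have -> : c^-1 * (y - c) = y / c - 1 by field.
  lra.
have V (x : R) : 0 < x -> x^-1 `^ (1 - alpha) = x `^ (alpha - 1).
  move=> x0; rewrite -powR_inv1 ?(ltW x0) // -powRrM; congr (_ `^ _); ring.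
rewrite !V //; set b := alpha - 1.
have bn : b != 0 by rewrite subr_eq0.
have -> : 1 - alpha = - b by rewrite /b; ring.
have -> : c `^ (alpha - 2) = c `^ b / c.
  rewrite -[X in _ / X]powRr1 ?(ltW c0) // -powRB ?cn ?implybT //.
  by congr (_ `^ _); rewrite /b; ring.
have -> : y `^ b = c `^ b * (y / c) `^ b.
  by rewrite -powRM ?(ltW c0) ?(ltW r0) // mulrC divfK.
have b1 : b <= 1 by rewrite /b; lra.
have := bernoulli_powR b1 r0.
have := powR_gt0 b c0; move: (c `^ b) ((y / c) `^ b) => C Y C0 h.
(* Multiplying by [b ^+ 2] clears the denominator [- b] and brings out the factor [b] of the
   Bernoulli inequality. *)
have bb : 0 < b ^+ 2 by rewrite exprn_even_gt0.
rewrite -(ler_pM2l bb) -subr_ge0.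
have -> : b ^+ 2 * ((C * Y - 1) / - b)
   - b ^+ 2 * ((C - 1) / - b - C / c * (y - c))
   = C * (b * (1 + b * (y / c - 1)) - b * Y) by field; rewrite cn bn.
by rewrite mulr_ge0 ?(ltW C0) // subr_ge0.
Qed.

Lemma tsallisE {R : realType} {k : nat} {alpha : R} {p : 'I_k -> R} :
  0 < alpha -> (forall n, 0 <= p n) -> \sum_n p n = 1 ->
  tsallis alpha p = \sum_n p n * ln_alpha alpha (p n)^-1.
Proof.
move=> a0 p0 p1; rewrite /tsallis /ln_alpha.
have [_|an] := eqVneq alpha 1.
  rewrite -sumrN; apply: eq_bigr => n _.
  have [->|pn] := eqVneq (p n) 0; first by rewrite !mul0r oppr0.
  by rewrite lnV ?mulrN // posrE lt0r pn p0.
rewrite -[in X in _ * X = _]p1 -sumrB mulr_sumr; apply: eq_bigr => n _.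
have [->|pn] := eqVneq (p n) 0; first by rewrite powR0 ?gt_eqF // subrr mulr0 mul0r.
have -> : (p n)^-1 `^ (1 - alpha) = p n `^ (alpha - 1).
  rewrite -powR_inv1 // -powRrM; congr (_ `^ _); ring.
rewrite -(mulr_powRB1 (p0 n) a0); field.
by rewrite subr_eq0 eq_sym.
Qed.

(** Weighting the tangent at [c] by [p n] and summing makes its linear term quadratic in [p], and
    [p n = 0] costs nothing. *)
Lemma tsallis_tangent {R : realType} {k : nat} {alpha c : R} {p : 'I_k -> R} :
  0 < alpha <= 2 -> 0 < c -> (forall n, 0 <= p n) -> \sum_n p n = 1 ->
  ln_alpha alpha c^-1 - c `^ (alpha - 2) * (\sum_n p n ^+ 2 - c)
    <= tsallis alpha p.
Proof.
move=> /andP[a0 a2] c0 p0 p1; rewrite tsallisE //.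
set L := ln_alpha alpha c^-1; set C := c `^ _.
have -> : L - C * (\sum_n p n ^+ 2 - c)
    = \sum_n p n * (L - C * (p n - c)).
  transitivity (\sum_n (p n * (L + C * c) - C * p n ^+ 2)).
    by rewrite sumrB -mulr_suml -mulr_sumr p1; ring.
  by apply: eq_bigr => n _; ring.
apply: ler_sum => n _.
have [->|pn] := eqVneq (p n) 0; first by rewrite !mul0r.
apply: ler_wpM2l => //; apply: ln_alphaV_tangent => //.
by rewrite lt0r pn p0.
Qed.

(** * Positive semidefinite matrices and the Hilbert-Schmidt form *)

Section Hermitian.
Context {R : realType} {d : nat}.
Implicit Types A B X : 'M[R[i]]_d.

Lemma hermsymmxP A : reflect (A ^t* = A) (A \is hermsymmx).
Proof.
apply: (iffP (is_hermitianmxP _ _ _)); rewrite expr0 scale1r => h.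
  by rewrite -h.
by rewrite h.
Qed.

(** The entry is the quadratic form of [A] at the conjugate transpose of row [i] of [U]. *)
Lemma psdmx_conj_diag_ge0 A (U : 'M[R[i]]_d) i :
  psdmx A -> 0 <= (U *m A *m U ^t*) i i.
Proof.
move=> [_ /(_ ((row i U) ^t*))]; congr (0 <= _).
rewrite map_trmx trmxK -map_mx_comp (map_mx_id (@conjCK _)).
by rewrite -row_mul !mxE; apply: eq_bigr => j _; rewrite !mxE.
Qed.

Lemma psdmx_spectral A : psdmx A ->
  exists (U : 'M[R[i]]_d) (D : 'rV[R[i]]_d),
    [/\ U *m U ^t* = 1%:M, A = U ^t* *m diag_mx D *m U & forall i, 0 <= D 0 i].
Proof.
move=> psdA; have [/hermitian_normalmx/orthomx_spectralP AE _] := psdA.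
set U := spectralmx A in AE; set D := spectral_diag A in AE.
have Uu : U \is unitarymx by apply: spectral_unitarymx.
have UU := unitarymxP Uu.
rewrite invmx_unitary // in AE.
exists U, D; split=> // i.
have := psdmx_conj_diag_ge0 _ U i psdA; congr (0 <= _).
by rewrite {1}AE !mulmxA UU mul1mx -mulmxA UU mulmx1 !mxE eqxx mulr1n.
Qed.

(** Diagonalizing [A] turns the trace into a sum of eigenvalues of [A] times diagonal entries of a
    conjugate of [B]. *)
Lemma tr_mulmx_psd_ge0 A B : psdmx A -> psdmx B -> 0 <= \tr (A *m B).
Proof.
move=> /psdmx_spectral[U [D [_ -> D0]]] psdB.
rewrite -!mulmxA mxtrace_mulC -!mulmxA mul_diag_mx.
apply: sumr_ge0 => i _; rewrite mxE mulr_ge0 // mulmxA.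
exact: psdmx_conj_diag_ge0.
Qed.

(** The eigenvalues are nonnegative with sum 1, so each is at most 1 and dominates its square. *)
Lemma density_matrix_purity_le1 A : density_matrix A -> \tr (A *m A) <= 1.
Proof.
move=> [/psdmx_spectral[U [D [UU -> D0]]]].
have -> : U ^t* *m diag_mx D *m U *m (U ^t* *m diag_mx D *m U)
    = U ^t* *m (diag_mx D *m diag_mx D) *m U.
  by rewrite !mulmxA -[_ *m U *m _]mulmxA UU mulmx1.
rewrite ![\tr (_ *m U)]mxtrace_mulC !mulmxA UU !mul1mx mxtrace_diag => D1.
rewrite mulmx_diag mxtrace_diag -[leRHS]D1; apply: ler_sum => i _.
rewrite !mxE ler_piMr // -D1 (bigD1 i) //= lerDl.
exact: sumr_ge0.
Qed.

(** On Hermitian matrices this is the Hilbert-Schmidt inner product; the real part makes it a form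
    with values in [R]. *)
Definition hsdot A B : R := complex.Re (\tr (A *m B)).

Lemma hsdotC A B : hsdot A B = hsdot B A.
Proof. by rewrite /hsdot mxtrace_mulC. Qed.

Lemma hsdotBl A B X : hsdot (A - B) X = hsdot A X - hsdot B X.
Proof. by rewrite /hsdot mulmxBl !raddfB. Qed.

Lemma hsdotBr A B X : hsdot X (A - B) = hsdot X A - hsdot X B.
Proof. by rewrite !(hsdotC X) hsdotBl. Qed.

Lemma hsdotZl (x : R) A X : hsdot (x%:C *: A) X = x * hsdot A X.
Proof.
rewrite /hsdot -scalemxAl mxtraceZ; case: (\tr _) => u v /=.
by rewrite mul0r subr0.
Qed.

Lemma hsdotZr (x : R) A X : hsdot X (x%:C *: A) = x * hsdot X A.
Proof. by rewrite !(hsdotC X) hsdotZl. Qed.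

Lemma hsdot_suml (I : finType) (F : I -> 'M[R[i]]_d) X :
  hsdot (\sum_i F i) X = \sum_i hsdot (F i) X.
Proof. by rewrite /hsdot mulmx_suml [\tr _]raddf_sum raddf_sum. Qed.

Lemma hsdot_herm_ge0 X : X \is hermsymmx -> 0 <= hsdot X X.
Proof.
move=> /hermsymmxP hX; rewrite /hsdot -[X in _ *m X]hX.
have : 0 <= \tr (X *m X ^t*).
  apply: sumr_ge0 => i _; rewrite mxE; apply: sumr_ge0 => j _.
  by rewrite !mxE mul_conjC_ge0.
by rewrite lecE => /andP[].
Qed.

Lemma hermsymmxB A B : A \is hermsymmx -> B \is hermsymmx ->
  A - B \is hermsymmx.
Proof.
move=> /hermsymmxP hA /hermsymmxP hB; apply/hermsymmxP.
by rewrite !raddfB /= hA hB.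
Qed.

Lemma hermsymmxZ (x : R) A : A \is hermsymmx -> x%:C *: A \is hermsymmx.
Proof.
move=> /hermsymmxP hA; apply/hermsymmxP.
rewrite linearZ map_mxZ hA; congr (_ *: _).
by apply/CrealP; rewrite complex_real.
Qed.

Lemma hermsymmx_sum (I : finType) (F : I -> 'M[R[i]]_d) :
  (forall i, F i \is hermsymmx) -> \sum_i F i \is hermsymmx.
Proof.
move=> hF; apply/hermsymmxP; rewrite !raddf_sum.
by apply: eq_bigr => i _; apply/hermsymmxP.
Qed.

End Hermitian.

(** * Outcome probabilities and their sums of squares *)

Lemma outcome_prob_ge0 {R : realType} {d k : nat} {P : 'I_k -> 'M[R[i]]_d}
    {rho : 'M[R[i]]_d} n :
  POVM P -> density_matrix rho -> 0 <= outcome_prob P rho n.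
Proof.
move=> [psdP _] [psdrho _].
by have := tr_mulmx_psd_ge0 _ _ (psdP n) psdrho; rewrite lecE => /andP[].
Qed.

Lemma outcome_prob_sum1 {R : realType} {d k : nat} {P : 'I_k -> 'M[R[i]]_d}
    {rho : 'M[R[i]]_d} :
  POVM P -> density_matrix rho -> \sum_n outcome_prob P rho n = 1.
Proof.
move=> [_ P1] [_ tr1].
by rewrite -[LHS](hsdot_suml _ P rho) P1 /hsdot mul1mx tr1.
Qed.

(* [X = \sum q P - t (rho - 1 / d)] is Hermitian, so [Tr X^2 >= 0] for every
   real [t]; the choice [t = T / (1 - 1 / d)], [T = \sum q^2], gives the claim. *)
Lemma MUM_coincidence_le {R : realType} {d M : nat} {kappa : R}
    {P : 'I_M -> 'I_d -> 'M[R[i]]_d} {rho : 'M[R[i]]_d} :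
  (2 <= d)%N -> MUM kappa P -> density_matrix rho ->
  \sum_b \sum_n outcome_prob (P b) rho n ^+ 2
    <= (M%:R + kappa * d%:R - 1) / d%:R.
Proof.
move=> d2 hP hrho.
have d2R : 2 <= d%:R :> R by rewrite ler_nat.
have dn0 : d%:R != 0 :> R by rewrite gt_eqF // (lt_le_trans _ d2R).
have dn1 : d%:R - 1 != 0 :> R.
  by rewrite gt_eqF // subr_gt0 (lt_le_trans _ d2R) ?ltr1n.
have realV : (d%:R^-1 : R[i]) = (d%:R^-1)%:C by rewrite fmorphV rmorph_nat.
pose p b n := outcome_prob (P b) rho n.
pose q b n := p b n - d%:R^-1.
have sq0 b : \sum_n q b n = 0.
  rewrite sumrB (outcome_prob_sum1 (MUM_povm hP b) hrho) sumr_const card_ord.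
  by rewrite -[_^-1 *+ _]mulr_natr mulVf ?subrr.
pose T := \sum_b \sum_n q b n ^+ 2.
have T0 : 0 <= T by apply: sumr_ge0 => b _; apply: sumr_ge0 => n _; apply: sqr_ge0.
(* In the square of [p = q + 1 / d] the cross terms cancel by [sq0], and each [b] adds
   [d * d^-2 = 1 / d]. *)
have TE : \sum_b \sum_n p b n ^+ 2 = T + M%:R / d%:R.
  have -> : M%:R / d%:R = \sum_(b < M) d%:R^-1 :> R.
    by rewrite sumr_const card_ord mulr_natl.
  rewrite -big_split /=; apply: eq_bigr => b _.
  transitivity (\sum_n (q b n ^+ 2 + (2 / d%:R * q b n + d%:R^-1 ^+ 2))).
    by apply: eq_bigr => n _; rewrite /q; field.
  rewrite !big_split /= -mulr_sumr sq0 mulr0 add0r; congr (_ + _).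
  by rewrite sumr_const card_ord -mulr_natl; field.
rewrite -[X in X <= _]/(\sum_b \sum_n p b n ^+ 2) TE.
pose S := \sum_b \sum_n (q b n)%:C *: P b n.
pose D := rho - (d%:R^-1)%:C *: 1%:M.
have hsdotS A : hsdot S A = \sum_b \sum_n q b n * hsdot (P b n) A.
  rewrite hsdot_suml; apply: eq_bigr => b _; rewrite hsdot_suml.
  by apply: eq_bigr => n _; rewrite hsdotZl.
have hsdotPD b n : hsdot (P b n) D = q b n.
  by rewrite hsdotBr hsdotZr {2}/hsdot mulmx1 (MUM_trace hP) /= mulr1.
pose c := kappa - (1 - kappa) / (d%:R - 1).
(* Each [b != a] contributes [1 / d] times the sum of [q b], which is 0. Within [a], the terms with
   [n != m] have weights summing to [- q a m], so the two efficiency values combine into [c]. *)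
have hsdotPS a m : hsdot (P a m) S = c * q a m.
  rewrite hsdotC hsdotS (bigD1 a) //= [X in _ + X]big1 ?addr0; last first.
    move=> b ba; under eq_bigr => n _ do
      rewrite /hsdot (MUM_unbiased hP) // realV /=.
    by rewrite -mulr_suml sq0 mul0r.
  have sqm := sq0 a; rewrite (bigD1 m) //= in sqm.
  rewrite (bigD1 m) //= {1}/hsdot (MUM_efficiency hP) eqxx /=.
  under eq_bigr => n nm do
    rewrite /hsdot (MUM_efficiency hP) (negPf nm) /=.
  rewrite -mulr_suml -[\sum_(_ < _ | _) _](addKr (q a m)) sqm /c.
  ring.
have SS : hsdot S S = c * T.
  rewrite hsdotS /T mulr_sumr; apply: eq_bigr => b _; rewrite mulr_sumr.
  by apply: eq_bigr => n _; rewrite hsdotPS; ring.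
have SD : hsdot S D = T.
  rewrite hsdotS; apply: eq_bigr => b _; apply: eq_bigr => n _.
  by rewrite hsdotPD.
have [[hermrho _] tr1] := hrho.
have DD : hsdot D D <= 1 - d%:R^-1.
  have purity : hsdot rho rho <= 1.
    by have := density_matrix_purity_le1 _ hrho; rewrite lecE => /andP[].
  have rho1 : hsdot rho 1%:M = 1 by rewrite /hsdot mulmx1 tr1.
  have h11 : hsdot 1%:M (1%:M : 'M[R[i]]_d) = d%:R.
    by rewrite /hsdot mulmx1 mxtrace1 -(rmorph_nat (real_complex R)).
  rewrite hsdotBl !hsdotBr !hsdotZl !hsdotZr (hsdotC 1%:M rho) rho1 h11.
  by rewrite mulVf //; lra.
have psdP b n : psdmx (P b n) by have [] := MUM_povm hP b.
pose s : R := 1 - d%:R^-1.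
have s0 : 0 < s by rewrite subr_gt0 invf_lt1 ?(lt_le_trans _ d2R) ?ltr1n.
pose t := T / s.
have hermX : S - t%:C *: D \is hermsymmx.
  apply: hermsymmxB; last first.
    apply: hermsymmxZ; apply: hermsymmxB => //; apply: hermsymmxZ.
    by apply/hermsymmxP; rewrite trmx1 map_mx1.
  apply: hermsymmx_sum => b; apply: hermsymmx_sum => n.
  by apply: hermsymmxZ; have [] := psdP b n.
have := hsdot_herm_ge0 _ hermX.
rewrite hsdotBl !hsdotBr !hsdotZl !hsdotZr (hsdotC D S) SS SD => X0.
pose g := kappa - d%:R^-1.
have g0 : 0 <= g by have /andP[h _] := MUM_kappa hP; rewrite subr_ge0.
have cs : c * s = g by rewrite /c /s /g; field; rewrite dn0 dn1.
(* Bounding [hsdot D D] by [s] in [X0] and using [t * s = T] leaves [0 <= (c - t) * T]; multiplying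
   by [s] gives the claim. *)
have TT : T * T <= g * T.
  have : t * (t * hsdot D D) <= t * (t * s).
    by rewrite !ler_wpM2l // divr_ge0 // ltW.
  have ts : t * s = T by rewrite divfK // gt_eqF.
  rewrite ts -cs => h.
  have : 0 <= (c * T - t * T) * s by rewrite mulr_ge0 ?(ltW s0) //; lra.
  have -> : (c * T - t * T) * s = c * s * T - t * s * T by ring.
  by rewrite ts subr_ge0.
have Tg : T <= g.
  by have [->|Tn] := eqVneq T 0; last by rewrite -(ler_pM2r (x := T)) // lt0r Tn.
rewrite [leRHS](_ : _ = g + M%:R / d%:R) ?lerD2r //.
by rewrite /g; field.
Qed.

(** * Averaging the tangent bound over the measurements *)

Theorem mainTheorem6 (R : realType) (d M : nat) (hd : (2 <= d)%N)
    (hM : (1 <= M)%N) (kappa : R) (P : 'I_M -> 'I_d -> 'M[complex R]_d)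
    (hP : MUM kappa P) (alpha : R) (halpha : 0 < alpha <= 2)
    (rho : 'M[complex R]_d) (hrho : density_matrix rho) :
  ln_alpha alpha (M%:R * d%:R / (M%:R + kappa * d%:R - 1))
    <= M%:R^-1 * \sum_(b < M) entropy alpha (P b) rho.
Proof.
have d0 : 0 < d%:R :> R by rewrite ltr0n (leq_trans _ hd).
have M0 : 0 < M%:R :> R by rewrite ltr0n.
have kd : 1 <= kappa * d%:R.
  by have /andP[h _] := MUM_kappa hP; rewrite -ler_pdivrMr // mul1r.
set K := M%:R + kappa * d%:R - 1.
have K0 : 0 < K by rewrite /K; lra.
(* With this tangent point, [M * c = K / d] is exactly the bound on the total of the squared
   probabilities, so the linear correction, summed over the measurements, has the favourable
   sign. *)
pose c := K / d%:R / M%:R.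
have c0 : 0 < c by rewrite !divr_gt0.
have -> : M%:R * d%:R / K = c^-1 by rewrite /c !invf_div mulrA.
rewrite mulrC ler_pdivlMr //.
set L := ln_alpha alpha c^-1; set C := c `^ (alpha - 2).
have lower b : L - C * (\sum_n outcome_prob (P b) rho n ^+ 2 - c)
    <= entropy alpha (P b) rho.
  have hb := MUM_povm hP b.
  apply: tsallis_tangent => // [n|]; first exact: outcome_prob_ge0.
  exact: outcome_prob_sum1.
apply: le_trans (ler_sum _ (fun b _ => lower b)).
rewrite sumrB -mulr_sumr sumrB !sumr_const card_ord -[L *+ M]mulr_natr -[c *+ M]mulr_natr.
have -> : c * M%:R = K / d%:R by rewrite /c divfK // gt_eqF.
rewrite lerBrDr gerDl mulr_ge0_le0 ?powR_ge0 // subr_le0.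
exact: MUM_coincidence_le.
Qed.
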